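(* Let $R$ be a unital $*$-ring and let $a,b\in R$ be such that $a$, $b$ and $ab$ are all core invertible. Then $(ab)^{(\#)}=a^{(\#)}b^{(\#)}$ if and only if $a^*a\,(ab)^{(\#)}=a^*b^{(\#)}$.
   Context: A unital $*$-ring is an associative ring $R$ with unity $1$ equipped with an involution $*:R\to R$ satisfying $(a+b)^*=a^*+b^*$, $(ab)^*=b^*a^*$ and $(a^* )^*=a$ for all $a,b\in R$. An element $a\in R$ is core invertible if there exists $x\in R$ with $axa=a$, $xax=x$, $(ax)^*=ax$, $xa^2=a$ and $ax^2=x$; such an $x$ is unique when it exists, is called the core inverse of $a$, and is denoted $a^{(\#)}$. *)

(* Defs.v *)
From HB Require Import structures.
From mathcomp Require Import all_boot all_algebra.
From mathcomp Require Import boolp classical_sets.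

Set Implicit Arguments.
Unset Strict Implicit.
Unset Printing Implicit Defensive.

Import GRing.Theory.
Local Open Scope ring_scope.

(* Built on pzRingType rather than nzRingType, so that 1 != 0 is not assumed. *)
HB.mixin Record PzRing_isStarRing R of GRing.PzRing R := {
  star : R -> R;
  starD : forall a b : R, star (a + b) = star a + star b;
  starM : forall a b : R, star (a * b) = star b * star a;
  starK : forall a : R, star (star a) = a
}.

#[short(type="starRingType")]
HB.structure Definition StarRing := {R of GRing.PzRing R & PzRing_isStarRing R}.

Section CoreInverse.
Variable R : starRingType.
Implicit Types a x y : R.

Definition is_core_inverse a x : Prop :=
  [/\ a * x * a = a, x * a * x = x, star (a * x) = a * x,
      x * a ^+ 2 = a & a * x ^+ 2 = x].

Definition core_invertible a : Prop := exists x, is_core_inverse a x.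

(* Total function; the value 0 at a non-core-invertible a is a junk value. *)
Definition core_inverse a : R := xget 0 [set x | is_core_inverse a x]%classic.

Lemma is_core_inverse_unique a x y :
  is_core_inverse a x -> is_core_inverse a y -> x = y.
Proof.
move=> [axa xax sax xaa axx] [aya yay say yaa ayy].
have eaxy : a * x = a * y.
  have h1 : a * x * (a * y) = a * y by rewrite mulrA axa.
  have h2 : a * y * (a * x) = a * x by rewrite mulrA aya.
  by rewrite -h2 -{1}say -{1}sax -starM h1 say.
rewrite -xax -mulrA eaxy -[in LHS]ayy.
by rewrite (mulrA a a) -expr2 mulrA xaa.
Qed.

Lemma core_inverseP a : core_invertible a -> is_core_inverse a (core_inverse a).
Proof. exact: (@xgetPex R 0 [set x | is_core_inverse a x]%classic). Qed.

Lemma core_inverseE a x : is_core_inverse a x -> core_inverse a = x.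
Proof.
move=> ax; apply: (is_core_inverse_unique _ ax).
by apply: core_inverseP; exists x.
Qed.

End CoreInverse.

(* Main.v *)
Require Import Defs.
From mathcomp Require Import all_boot all_algebra.
Local Open Scope ring_scope.

Import GRing.Theory.

(** Write [x], [y], [c] for the core inverses of [a], [b], [a * b].  The element
    [a * x] is a self-adjoint idempotent with [star a * (a * x) = star a] and
    [star x * star a = a * x], so left multiplication by [star a] identifies two
    elements exactly when left multiplication by [a * x] does
    ([star_mul_eqP]).  Since [a * x * a = a], the right-hand condition
    [star a * a * c = star a * y] therefore says [a * c = a * x * y].  This
    clearly follows from [c = x * y].  Conversely, multiplying it by [x] gives
    [x * a * c = x * y], and [x * a * c = c] because [c = a * b * c ^+ 2] lies
    in the right ideal [a * R], on which [x * a] acts as the identity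
    ([core_inverse_mulKl]). *)

Lemma star_mul_core_inverse (R : starRingType) (a x : R) :
  is_core_inverse a x -> star a * (a * x) = star a.
Proof. by case=> axa _ sax _ _; rewrite -sax -starM axa. Qed.

(** [star a] and [a * x] are left multiples of each other, hence have the same
    right annihilator. *)
Lemma star_mul_eqP (R : starRingType) (a x u v : R) :
  is_core_inverse a x ->
  star a * u = star a * v <-> a * x * u = a * x * v.
Proof.
move=> ax; have saax := star_mul_core_inverse _ _ _ ax.
case: ax => _ _ sax _ _; split=> e.
  by rewrite -sax starM -!mulrA e.
by rewrite -saax -!(mulrA (star a)) e.
Qed.

Lemma core_inverse_mulKl (R : starRingType) (a x z : R) :
  is_core_inverse a x -> x * a * (a * z) = a * z.
Proof. by case=> _ _ _ xaa _; rewrite mulrA -(mulrA x) -expr2 xaa. Qed.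

Theorem theorem3p7 (R : starRingType) (a b : R)
    (ha : core_invertible a) (hb : core_invertible b)
    (hab : core_invertible (a * b)) :
  core_inverse (a * b) = core_inverse a * core_inverse b <->
  star a * a * core_inverse (a * b) = star a * core_inverse b.
Proof.
have ax := core_inverseP ha; have [_ _ _ _ abcc] := core_inverseP hab.
move: (core_inverse a) (core_inverse b) (core_inverse (a * b)) ax abcc.
move=> x y c ax abcc; have [axa xax _ _ _] := ax.
have xac : x * a * c = c by rewrite -abcc -(mulrA a) (core_inverse_mulKl _ _ _ _ ax).
rewrite -mulrA (star_mul_eqP _ _ _ _ _ ax) mulrA axa; split=> [->|ac].
  by rewrite mulrA.
by rewrite -xac -mulrA ac !mulrA xax.
Qed.
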